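(* For every instance of the ATP problem with (possibly non-identical) request distributions $\mathcal D_1,\dots,\mathcal D_T$ and with $B_0=B=1$, there exists an online algorithm that achieves an expected profit of at least $\tfrac1{22}$ times the expected profit of the optimal offline algorithm.
   Context: ATP (Asymmetric Trading Prophets) problem. A decision maker interacts with $T$ sequentially arriving requests to trade copies of a product. She has capacity $B\ge 1$ (she may hold at most $B$ copies at any time) and starts with an initial inventory of $B_0\in\{0,\dots,B\}$ copies. It is assumed throughout that $T\ge B_0$ and $B\le B_0+T$. At time $t\in\{1,\dots,T\}$ a price tuple $(b_t,s_t)$ is revealed, with $b_t\in[0,+\infty]$ (the cost of buying a copy; $b_t=+\infty$ means buying is impossible) and $s_t\in[0,\infty)$ (the revenue from selling a copy). The tuple $(b_t,s_t)$ is drawn from a publicly known distribution $\mathcal D_t$, independently across $t$, while $b_t$ and $s_t$ may be arbitrarily correlated with each other and need not be equal. At time $t$ she takes exactly one action: Buy one copy at price $b_t$ (allowed if she holds at most $B-1$ copies), Sell one copy at price $s_t$ (allowed if she holds at least one copy), or Skip (do nothing). Profit is total revenue from sales minus total cost of purchases. An online algorithm (possibly randomized) irrevocably chooses its action at time $t$ knowing only the distributions, the tuples revealed up to and including time $t$, and its past actions. The optimal offline algorithm knows all realized tuples in advance and attains the maximum possible profit for each realization, subject to the same inventory constraints; its expected profit is the expectation of this maximum. *)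

(* Defs.v *)
From HB Require Import structures.
From mathcomp Require Import all_boot all_order all_algebra.
From mathcomp Require Import all_classical all_reals all_analysis.
From mathcomp Require Import measurable_realfun.

Set Implicit Arguments.
Unset Strict Implicit.
Unset Printing Implicit Defensive.

Import Order.TTheory GRing.Theory Num.Theory.
Local Open Scope classical_set_scope.
Local Open Scope ring_scope.

Variant action := Buy | Sell | Skip.

Definition option_bool_of_action (a : action) : option bool :=
  match a with Buy => Some true | Sell => Some false | Skip => None end.

Definition action_of_option_bool (o : option bool) : action :=
  match o with Some true => Buy | Some false => Sell | None => Skip end.

Lemma option_bool_of_actionK :
  cancel option_bool_of_action action_of_option_bool.
Proof. by case. Qed.

HB.instance Definition _ := Finite.copy action (can_type option_bool_of_actionK).

(* The pair (b, s): b is the buying cost, s the selling revenue. The sign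
   constraints on b and s are imposed almost surely, in [atp_instance]. *)
Notation price R := (\bar R * measurableTypeR R)%type.

Definition admissible_price (R : realType) : set (price R) :=
  [set p | (0 <= p.1)%E /\ 0 <= (p.2 : R)].

Definition cons_price (R : realType) (n : nat)
    (z : price R * n.-tuple (price R)) : n.+1.-tuple (price R) :=
  [tuple of z.1 :: z.2].

Lemma measurable_cons_price (R : realType) (n : nat) :
  measurable_fun [set: price R * n.-tuple (price R)] (@cons_price R n).
Proof. exact: (measurable_cons measurable_fst measurable_snd). Qed.

HB.instance Definition _ (R : realType) (n : nat) :=
  isMeasurableFun.Build _ _ _ _ (@cons_price R n) (@measurable_cons_price R n).

(* The product measure D 0 \x ... \x D (T - 1), i.e. the joint law of the
   price sequence when the D t are sampled independently. *)
Fixpoint product_law (R : realType) (T : nat) :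
    ('I_T -> probability (price R) R) -> probability (T.-tuple (price R)) R :=
  match T with
  | 0 => fun _ => \d_([tuple] : 0.-tuple (price R))
  | n.+1 => fun D =>
      distribution (D ord0 \x product_law (fun i => D (lift ord0 i)))%E
                   (@cons_price R n)
  end.

Lemma product_law_box (R : realType) (T : nat)
    (D : 'I_T -> probability (price R) R) (A : 'I_T -> set (price R)) :
  (forall t, measurable (A t)) ->
  product_law D [set x | forall t, A t (tnth x t)] = (\prod_(t < T) D t (A t))%E.
Proof.
elim: T D A => [|n IHn] D A mA.
  by rewrite big_ord0 /= diracE mem_set //= => -[].
rewrite big_ord_recl /= /distribution /pushforward /=.
set E := [set x : n.-tuple _ | forall t, A (lift ord0 t) (tnth x t)].
have mE : measurable E.
  rewrite (_ : E = \bigcap_(t in [set: 'I_n])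
      ((fun x => tnth x t) @^-1` A (lift ord0 t))).
    apply: fin_bigcap_measurable => // t _.
    by rewrite -[X in measurable X]setTI; apply: measurable_tnth.
  by apply/seteqP; split=> x /= h t; [move=> _|]; exact: h.
rewrite (_ : _ @^-1` _ = A ord0 `*` E).
  by rewrite product_measure1E// -IHn.
apply/seteqP; split=> [[p x] /= h|[p x] /= [h0 h] t].
  split=> [|t]; first by have := h ord0; rewrite tnth0.
  by have := h (lift ord0 t); rewrite tnthS.
by case: (unliftP ord0 t) => [j ->|->]; rewrite ?tnthS ?tnth0.
Qed.

Record atp_instance (R : realType) := ATPInstance {
  horizon : nat;
  capacity : nat;
  initial : nat;
  law : 'I_horizon -> probability (price R) R;
  capacity_gt0 : (1 <= capacity)%N;
  initial_le_capacity : (initial <= capacity)%N;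
  initial_le_horizon : (initial <= horizon)%N;
  capacity_le : (capacity <= initial + horizon)%N;
  law_admissible : forall t, law t (@admissible_price R) = 1%E
}.

Definition next_stock (h : nat) (a : action) : nat :=
  match a with Buy => h.+1 | Sell => h.-1 | Skip => h end.

Definition allowed (R : realType) (B h : nat) (p : price R) (a : action) : bool :=
  match a with
  | Buy => (h < B)%N && (p.1 < +oo)%E
  | Sell => (0 < h)%N
  | Skip => true
  end.

(* [feasible B h x a]: starting from h copies, the action sequence a has one
   action per price tuple of x and is allowed at every step. *)
Fixpoint feasible (R : realType) (B h : nat) (x : seq (price R))
    (acts : seq action) : bool :=
  match x, acts with
  | [::], [::] => true
  | p :: x', a :: acts' =>
      allowed B h p a && feasible B (next_stock h a) x' acts'
  | _, _ => false
  end.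

Definition gain (R : realType) (p : price R) (a : action) : \bar R :=
  match a with
  | Buy => (- p.1)%E
  | Sell => (p.2 : R)%:E
  | Skip => 0%E
  end.

Definition profit (R : realType) (x : seq (price R)) (acts : seq action) : \bar R :=
  (\sum_(pa <- zip x acts) gain pa.1 pa.2)%E.

(* The neutral element -oo is never the value of the maximum: skipping at
   every step is feasible. *)
Definition offline_profit (R : realType) (B B0 T : nat) (x : T.-tuple (price R))
    : \bar R :=
  \big[maxe/-oo%E]_(a : T.-tuple action | feasible B B0 x a) profit x a.

Definition expected_offline_profit (R : realType) (I : atp_instance R) : \bar R :=
  (\int[product_law (@law R I)]_x offline_profit (capacity I) (initial I) x)%E.

(* [decide w x h] is the action taken when the random seed is w, the tuples
   revealed so far (current one included) are x, and the past actions are h;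
   [play decide w x n] lists the first n actions so taken. *)
Fixpoint play (R : realType) (S : Type)
    (decide : S -> seq (price R) -> seq action -> action)
    (w : S) (x : seq (price R)) (n : nat) : seq action :=
  match n with
  | 0 => [::]
  | m.+1 => let h := play decide w x m in rcons h (decide w (take m.+1 x) h)
  end.

Record online_algorithm (R : realType) (I : atp_instance R) := OnlineAlgorithm {
  seed_display : measure_display;
  seed : measurableType seed_display;
  seed_law : probability seed R;
  decide : seed -> seq (price R) -> seq action -> action;
  decide_measurable : forall (n : nat) (h : seq action) (a : action),
    measurable [set z : seed * n.-tuple (price R) | decide z.1 z.2 h = a];
  decide_feasible : forall (w : seed) (x : (horizon I).-tuple (price R)),
    feasible (capacity I) (initial I) x (play decide w x (horizon I))
}.

(* The seed is independent of the prices. *)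
Definition expected_online_profit (R : realType) (I : atp_instance R)
    (A : online_algorithm I) : \bar R :=
  (\int[seed_law A \x product_law (@law R I)]_z
     profit z.2 (play (@decide R I A) z.1 z.2 (horizon I)))%E.

(* Main.v *)
(* Let q_t be the marginal value of holding a copy after time t under the
   optimal online policy: q_T = 0 and q_(t-1) = q_t + S_t - A_t, where
   S_t = E (s_t - q_t)^+ and A_t = E (q_t - b_t)^+. The policy that sells iff
   s_t > q_t and buys iff b_t < q_t earns q_0 + sum_t A_t. Let h_t be the stock
   after time t of an arbitrary offline strategy; telescoping q_t h_t shows that
   it earns at most
     q_0 + sum_t ((q_t - b_t)^+ + (s_t - q_t)^+ + A_t),
   whose mean is 2 q_0 + 3 sum_t A_t. So the policy is even 1/3-competitive.
   This needs the E s_t to be finite; if some E s_t is infinite, holding the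
   initial copy until time t and selling it there has infinite profit. *)
Require Import Defs.
From mathcomp Require Import all_boot all_order all_algebra.
From mathcomp Require Import all_classical all_reals all_analysis.
From mathcomp Require Import measurable_realfun.
From mathcomp Require Import lra.

Set Implicit Arguments.
Unset Strict Implicit.
Unset Printing Implicit Defensive.

Import Order.TTheory GRing.Theory Num.Theory.
Local Open Scope classical_set_scope.
Local Open Scope ring_scope.

(** * Integrals over the seed and over the price sequence *)

(** A nonnegative integral is a supremum over the simple functions below the integrand, and a larger
    integrand has more of them. This bounds the mean of [offline_profit] without a measurability
    proof for it. *)
Lemma ge0_le_integral_nonmeasurable d (T : measurableType d) (R : realType)
    (mu : {measure set T -> \bar R}) (f g : T -> \bar R) :
  (forall x, 0 <= f x)%E -> (forall x, f x <= g x)%E ->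
  (\int[mu]_x f x <= \int[mu]_x g x)%E.
Proof.
move=> f0 fg; have g0 x : (0 <= g x)%E by exact: le_trans (fg x).
rewrite !ge0_integralTE//; apply: ereal_sup_le => _ [h hf <-].
by exists h => // x; exact: le_trans (fg x).
Qed.

(** Tonelli applies to the positive and negative parts separately, so the identity also covers
    infinite integrals. It serves to drop the seed of a deterministic algorithm. *)
Lemma integral_snd d d' (S : measurableType d) (T : measurableType d')
    (R : realType) (P : probability S R) (Q : probability T R)
    (f : T -> \bar R) :
  measurable_fun [set: T] f ->
  (\int[P \x Q]_z f z.2 = \int[Q]_x f x)%E.
Proof.
have ge0_case (g : T -> \bar R) : measurable_fun [set: T] g ->
    (forall x, 0 <= g x)%E -> (\int[P \x Q]_z g z.2 = \int[Q]_x g x)%E.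
  move=> mg g0; rewrite fubini_tonelli1//=; last first.
    exact: measurableT_comp.
  transitivity (\int[P]_x cst (\int[Q]_y g y) x)%E; first by [].
  by rewrite integral_cst// [X in (_ * X)%E]probability_setT mule1.
move=> mf; rewrite integralE [RHS]integralE; congr (_ - _)%E.
  by rewrite -ge0_case; [apply: eq_integral => z _; rewrite !funeposE
                      |exact: measurable_funepos|].
by rewrite -ge0_case; [apply: eq_integral => z _; rewrite !funenegE
                      |exact: measurable_funeneg|].
Qed.

Lemma integral_product_lawS (R : realType) (n : nat)
    (D : 'I_n.+1 -> probability (price R) R)
    (f : n.+1.-tuple (price R) -> \bar R) :
  measurable_fun [set: n.+1.-tuple (price R)] f -> (forall x, 0 <= f x)%E ->
  (\int[product_law D]_x f x =
   \int[D ord0]_p \int[product_law (fun i => D (lift ord0 i))]_x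
     f (cons_price (p, x)))%E.
Proof.
move=> mf f0; rewrite /= ge0_integral_distribution//.
rewrite fubini_tonelli1//=.
by apply: measurableT_comp => //; exact: measurable_cons_price.
Qed.

(** * Excess of one price over a threshold *)

Definition sell_excess (R : realType) (q : R) (p : price R) : \bar R :=
  maxe (((p.2 : R) - q)%:E) 0%E.

Definition buy_excess (R : realType) (q : R) (p : price R) : \bar R :=
  maxe (q%:E - p.1)%E 0%E.

(** [fine] sends an infinite mean to 0, so this is S_t only when the mean is finite, which
    [integral_sell_excess] establishes. *)
Definition mean_sell_excess (R : realType) (P : probability (price R) R)
  (q : R) : R := fine (\int[P]_p sell_excess q p)%E.

Definition mean_buy_excess (R : realType) (P : probability (price R) R)
  (q : R) : R := fine (\int[P]_p buy_excess q p)%E.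

Section one_price.
Context (R : realType) (P : probability (price R) R).
Implicit Types (q : R) (p : price R).

Lemma measurable_sell_excess q : measurable_fun [set: price R] (sell_excess q).
Proof.
apply: measurable_maxe => //; apply/measurable_EFinP.
by apply: measurable_funB => //; exact: measurable_snd.
Qed.

Lemma measurable_buy_excess q : measurable_fun [set: price R] (buy_excess q).
Proof. by apply: measurable_maxe => //; exact: emeasurable_funB. Qed.

Lemma sell_excess_ge0 q p : (0 <= sell_excess q p)%E.
Proof. by rewrite le_max lexx orbT. Qed.

Lemma buy_excess_ge0 q p : (0 <= buy_excess q p)%E.
Proof. by rewrite le_max lexx orbT. Qed.

Lemma mean_sell_excess_ge0 q : 0 <= mean_sell_excess P q.
Proof. by rewrite fine_ge0// integral_ge0// => p _; exact: sell_excess_ge0. Qed.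

Lemma mean_buy_excess_ge0 q : 0 <= mean_buy_excess P q.
Proof. by rewrite fine_ge0// integral_ge0// => p _; exact: buy_excess_ge0. Qed.

(** Raising the threshold from 0 to q lowers the excess, so finiteness at threshold 0 carries
    over. *)
Lemma integral_sell_excess q : 0 <= q ->
  (\int[P]_p sell_excess 0 p < +oo)%E ->
  (\int[P]_p sell_excess q p = (mean_sell_excess P q)%:E)%E.
Proof.
move=> q0 fin; rewrite fineK// ge0_fin_numE; last first.
  by apply: integral_ge0 => p _; exact: sell_excess_ge0.
apply: le_lt_trans fin; apply: ge0_le_integral => //.
- by move=> p _; exact: sell_excess_ge0.
- exact: measurable_sell_excess.
- exact: measurable_sell_excess.
move=> p _; rewrite /sell_excess ge_max !le_max lexx orbT andbT lee_fin.
by apply/orP; left; lra.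
Qed.

Lemma ae_admissible : P (@admissible_price R) = 1%E ->
  {ae P, forall p, @admissible_price R p}.
Proof.
move=> PA.
have mA : measurable (@admissible_price R).
  rewrite (_ : @admissible_price R =
    (fst @^-1` `[0%E, +oo[%classic) `&` (snd @^-1` `[0, +oo[%classic)).
    apply: measurableI.
      by rewrite -[X in measurable X]setTI; apply: measurable_fst => //; exact: emeasurable_itv.
    by rewrite -[X in measurable X]setTI; apply: measurable_snd => //; exact: measurable_itv.
  by apply/seteqP; split=> p /=; rewrite !in_itv /= !andbT => -[].
exists (~` @admissible_price R); split => //; first exact: measurableC.
by rewrite probability_setC// PA subee.
Qed.

(** Almost surely b >= 0, hence (q - b)^+ <= q. *)
Lemma integral_buy_excess_le q : 0 <= q -> P (@admissible_price R) = 1%E ->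
  (\int[P]_p buy_excess q p <= q%:E)%E.
Proof.
move=> q0 PA.
have -> : (q%:E = \int[P]_p (cst q%:E p))%E.
  by rewrite integral_cst// [X in (_ * X)%E]probability_setT mule1.
apply: ae_ge0_le_integral => //=.
- by move=> p _; exact: buy_excess_ge0.
- exact: measurable_buy_excess.
apply: filterS (ae_admissible PA) => p [p1 _] _.
rewrite ge_max lee_fin q0 andbT -[leRHS]adde0; apply: leeD2l.
by rewrite oppe_le0.
Qed.

Lemma integral_buy_excess q : 0 <= q -> P (@admissible_price R) = 1%E ->
  (\int[P]_p buy_excess q p = (mean_buy_excess P q)%:E)%E.
Proof.
move=> q0 PA; rewrite fineK// ge0_fin_numE; last first.
  by apply: integral_ge0 => p _; exact: buy_excess_ge0.
by apply: le_lt_trans (integral_buy_excess_le q0 PA) _; rewrite ltry.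
Qed.

Lemma mean_buy_excess_le q : 0 <= q -> P (@admissible_price R) = 1%E ->
  mean_buy_excess P q <= q.
Proof.
by move=> q0 PA; rewrite -lee_fin -integral_buy_excess ?integral_buy_excess_le.
Qed.

End one_price.

(** * The threshold policy: values, online play, feasibility, measurability *)

Section recursion.
Context (R : realType).
Implicit Types (q : R) (qs : seq R) (p : price R) (h n : nat).

(* [hold_value D] is q_0, [empty_value D] is the sum of the A_t, and
   [thresholds D] is the sequence q_1, ..., q_T. *)
Fixpoint hold_value n : ('I_n -> probability (price R) R) -> R :=
  match n with
  | 0 => fun _ => 0
  | m.+1 => fun D =>
      let q := hold_value (fun i => D (lift ord0 i)) in
      q + mean_sell_excess (D ord0) q - mean_buy_excess (D ord0) q
  end.

Fixpoint empty_value n : ('I_n -> probability (price R) R) -> R :=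
  match n with
  | 0 => fun _ => 0
  | m.+1 => fun D =>
      let D' := fun i => D (lift ord0 i) in
      mean_buy_excess (D ord0) (hold_value D') + empty_value D'
  end.

Fixpoint thresholds n : ('I_n -> probability (price R) R) -> seq R :=
  match n with
  | 0 => fun _ => [::]
  | m.+1 => fun D =>
      let D' := fun i => D (lift ord0 i) in hold_value D' :: thresholds D'
  end.

Definition threshold_rule q h p : action :=
  if (0 < h)%N then (if q < p.2 then Sell else Skip)
  else (if (p.1 < q%:E)%E then Buy else Skip).

(** The policy as a recursion on the remaining prices, which suits induction on the horizon;
    [threshold_decide] is the same policy as an online rule. *)
Fixpoint threshold_acts qs h (x : seq (price R)) : seq action :=
  match qs, x with
  | q :: qs', p :: x' =>
      let a := threshold_rule q h p in
      a :: threshold_acts qs' (next_stock h a) x'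
  | _, _ => [::]
  end.

(** [size past] is the 0-based index n of the current request, and entry n of q_1, ..., q_T is the
    value of a copy after that request. The stock is replayed from the past actions. *)
Definition threshold_decide qs h (x : seq (price R)) (past : seq action) :=
  threshold_rule (nth 0 qs (size past)) (foldl next_stock h past)
    (nth (0%E, 0) x (size past)).

Lemma next_stock_threshold_le1 q h p : (h <= 1)%N ->
  (next_stock h (threshold_rule q h p) <= 1)%N.
Proof. by rewrite /threshold_rule; case: h => [|[]]//= _; case: ifP. Qed.

Lemma size_threshold_acts qs h (x : seq (price R)) :
  size (threshold_acts qs h x) = minn (size qs) (size x).
Proof.
elim: qs h x => [|q qs IH] h [|p x] //=.
by rewrite IH minnSS.
Qed.

Lemma nth_threshold_acts qs h (x : seq (price R)) n :
  (n < size qs)%N -> (n < size x)%N ->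
  nth Skip (threshold_acts qs h x) n =
  threshold_rule (nth 0 qs n)
    (foldl next_stock h (take n (threshold_acts qs h x))) (nth (0%E, 0) x n).
Proof.
elim: qs h x n => [|q qs IH] h [|p x] [|n] //= nq nx.
by rewrite IH.
Qed.

Lemma size_play (S : Type) (d : S -> seq (price R) -> seq action -> action) w x n :
  size (play d w x n) = n.
Proof. by elim: n => //= n IH; rewrite size_rcons IH. Qed.

Lemma play_threshold (S : Type) (w : S) qs h (x : seq (price R)) n :
  size qs = n -> size x = n ->
  play (fun _ => threshold_decide qs h) w x n = threshold_acts qs h x.
Proof.
move=> sq sx; have sa : size (threshold_acts qs h x) = n.
  by rewrite size_threshold_acts sq sx minnn.
(* The claim is generalized to prefixes of length m <= n, since [play] grows by one action at the
   end. *)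
rewrite -[RHS]take_size sa; elim: {-2}n (leqnn n) => [|m IH] mn.
  by rewrite take0.
rewrite /= (take_nth Skip) ?sa// -IH ?(ltnW mn)//.
rewrite nth_threshold_acts ?sq ?sx// -IH ?(ltnW mn)//.
(* The revealed prefix has length m + 1, so its entry m is the current tuple. *)
by rewrite /threshold_decide size_play nth_take.
Qed.

Lemma feasible_threshold qs h (x : seq (price R)) :
  (h <= 1)%N -> size qs = size x -> feasible 1 h x (threshold_acts qs h x).
Proof.
elim: qs h x => [|q qs IH] h [|p x] //= h1 [sq].
rewrite IH ?next_stock_threshold_le1// andbT /threshold_rule.
case: h h1 => [|[]]//= _; case: ifP => //= pq.
(* A cost strictly below a real threshold is finite, as [allowed] demands of a purchase. *)
by rewrite (lt_trans pq)// ltry.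
Qed.

Lemma profit_cons p x (a : action) acts :
  profit (p :: x) (a :: acts) = (gain p a + profit x acts)%E.
Proof. by rewrite /profit /= big_cons. Qed.

Lemma profit_nil (x : seq (price R)) : profit x [::] = 0%E.
Proof. by rewrite /profit; case: x => *; rewrite big_nil. Qed.

Lemma size_thresholds n (D : 'I_n -> probability (price R) R) :
  size (thresholds D) = n.
Proof. by elim: n D => //= n IH D; rewrite IH. Qed.

Definition threshold_profit qs h (x : seq (price R)) : \bar R :=
  profit x (threshold_acts qs h x).

Lemma measurable_gain (a : action) : measurable_fun [set: price R] (fun p => gain p a).
Proof.
case: a => //=; first exact: measurableT_comp.
by apply/measurable_EFinP; exact: measurable_snd.
Qed.

Lemma measurable_threshold_rule q h a :
  measurable [set p | threshold_rule q h p = a].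
Proof.
have ms : measurable [set p : price R | q < p.2].
  rewrite (_ : [set _ | _] = snd @^-1` `]q, +oo[%classic).
    by rewrite -[X in measurable X]setTI; apply: measurable_snd => //;
      exact: measurable_itv.
  by apply/seteqP; split=> p /=; rewrite in_itv /= andbT.
have mb : measurable [set p : price R | (p.1 < q%:E)%E].
  rewrite (_ : [set _ | _] = fst @^-1` `]-oo, q%:E[%classic).
    by rewrite -[X in measurable X]setTI; apply: measurable_fst => //;
      exact: emeasurable_itv.
  by apply/seteqP; split=> p /=; rewrite in_itv.
rewrite /threshold_rule; case: (0 < h)%N; case: a.
- rewrite (_ : [set _ | _] = set0)//.
  by apply/seteqP; split=> p //=; case: ifP.
- rewrite (_ : [set _ | _] = [set p | q < p.2])//.
  by apply/seteqP; split=> p /=; case: ifP.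
- rewrite (_ : [set _ | _] = ~` [set p | q < p.2]); first exact: measurableC.
  by apply/seteqP; split=> p /=; case: ifP.
- rewrite (_ : [set _ | _] = [set p | (p.1 < q%:E)%E])//.
  by apply/seteqP; split=> p /=; case: ifP.
- rewrite (_ : [set _ | _] = set0)//.
  by apply/seteqP; split=> p //=; case: ifP.
rewrite (_ : [set _ | _] = ~` [set p | (p.1 < q%:E)%E]); first exact: measurableC.
by apply/seteqP; split=> p /=; case: ifP.
Qed.

Lemma measurable_threshold_profit qs h n :
  measurable_fun [set: n.-tuple (price R)] (fun x => threshold_profit qs h x).
Proof.
elim: n qs h => [|n IH] qs h.
  rewrite (_ : (fun _ => _) = cst 0%E)//; apply/funext => x.
  by rewrite tuple0 /threshold_profit; case: qs => [|q qs] /=; rewrite profit_nil.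
case: qs => [|q qs].
  rewrite (_ : (fun _ => _) = cst 0%E)//; apply/funext => x.
  by rewrite /threshold_profit profit_nil.
(* [F a] is the profit when the first action is [a]; the true profit switches between three such
   functions on measurable events. *)
pose F a (x : n.+1.-tuple (price R)) :=
  (gain (thead x) a + threshold_profit qs (next_stock h a) [tuple of behead x])%E.
have mth : measurable_fun [set: n.+1.-tuple (price R)] (@thead n (price R)).
  exact: measurable_tnth.
have mF a : measurable_fun [set: n.+1.-tuple (price R)] (F a).
  apply: emeasurable_funD; first exact: (measurableT_comp (measurable_gain a) mth).
  apply: (measurableT_comp (IH qs (next_stock h a))).
  exact: measurable_behead.
have mA a : measurable_fun [set: n.+1.-tuple (price R)]
    (fun x => threshold_rule q h (thead x) == a).
  apply: (measurable_fun_bool true) => //.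
  rewrite setTI (_ : _ @^-1` _ = @thead n _ @^-1` [set p | threshold_rule q h p = a]).
    by rewrite -[X in measurable X]setTI; apply: mth => //; exact: measurable_threshold_rule.
  by apply/seteqP; split=> x /= /eqP.
rewrite (_ : (fun _ => _) = fun x =>
  if threshold_rule q h (thead x) == Buy then F Buy x else
  if threshold_rule q h (thead x) == Sell then F Sell x else F Skip x).
  by do 2 (apply: measurable_fun_ifT => //).
apply/funext => x; rewrite (tuple_eta x) /threshold_profit /= profit_cons.
by rewrite /F theadE /= ; case: threshold_rule.
Qed.

(** A purchase costs less than q_t and a sale earns more than q_t >= 0, so step t loses at most
    q_t. *)
Lemma threshold_profit_ge qs h (x : seq (price R)) :
  (h <= 1)%N -> (forall q, q \in qs -> 0 <= q) ->
  (- (\sum_(q <- qs) q)%:E <= threshold_profit qs h x)%E.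
Proof.
have sum_ge0 (s : seq R) : (forall q, q \in s -> 0 <= q) -> 0 <= \sum_(q <- s) q.
  by move=> s0; rewrite big_seq sumr_ge0.
elim: qs h x => [|q qs IH] h x h1 qs0.
  by rewrite big_nil oppe0 /threshold_profit profit_nil.
case: x => [|p x].
  by rewrite /threshold_profit profit_nil oppe_le0 lee_fin sum_ge0.
have q0 : 0 <= q by rewrite qs0 ?mem_head.
rewrite /threshold_profit /= profit_cons big_cons /= opprD EFinD.
apply: leeD.
  rewrite /threshold_rule; case: h h1 => [|[]]//= _; case: ifP => //= pq.
  - by rewrite EFinN leeN2 ltW.
  - by rewrite lee_fin oppr_le0.
  - by rewrite lee_fin; move: (p.2 : R) pq => s pq; lra.
  - by rewrite lee_fin oppr_le0.
apply: IH; first exact: next_stock_threshold_le1.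
by move=> r rq; rewrite qs0// in_cons rq orbT.
Qed.

Definition admissible_law n (D : 'I_n -> probability (price R) R) :=
  forall t, D t (@admissible_price R) = 1%E.

(* [sell_excess 0] is the positive part of the selling price. *)
Definition integrable_revenue n (D : 'I_n -> probability (price R) R) :=
  forall t, (\int[D t]_p sell_excess 0 p < +oo)%E.

(** The recursion q + S - A stays nonnegative because A <= q and S >= 0. *)
Lemma hold_value_ge0 n (D : 'I_n -> probability (price R) R) :
  admissible_law D -> 0 <= hold_value D.
Proof.
elim: n D => //= n IH D aD.
have q0 := IH _ (fun i => aD (lift ord0 i)).
have := mean_buy_excess_le q0 (aD ord0).
have := mean_sell_excess_ge0 (D ord0) (hold_value (fun i => D (lift ord0 i))).
lra.
Qed.

Lemma empty_value_ge0 n (D : 'I_n -> probability (price R) R) :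
  0 <= empty_value D.
Proof.
by elim: n D => //= n IH D; rewrite addr_ge0 ?mean_buy_excess_ge0.
Qed.

Lemma thresholds_ge0 n (D : 'I_n -> probability (price R) R) :
  admissible_law D -> forall q, q \in thresholds D -> 0 <= q.
Proof.
elim: n D => //= n IH D aD q; rewrite in_cons => /orP[/eqP ->|].
  by apply: hold_value_ge0 => i; exact: aD.
by apply: IH => i; exact: aD.
Qed.

Lemma integral_addcst (P : probability (price R) R) (f : price R -> \bar R) (c : R) :
  0 <= c -> measurable_fun [set: price R] f -> (forall p, 0 <= f p)%E ->
  (\int[P]_p (f p + c%:E) = \int[P]_p f p + c%:E)%E.
Proof.
move=> c0 mf f0; rewrite ge0_integralD//.
  by rewrite integral_cst// [X in (_ * X)%E]probability_setT mule1.
Qed.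

End recursion.

(** * Expected profit of the threshold policy *)

Section values.
Context (R : realType).
Implicit Types (p : price R) (h n : nat).

(* Adding the thresholds makes the profit nonnegative, so that Tonelli's theorem
   applies to it without any integrability to check. *)
Lemma threshold_profit_shift_ge0 qs h (x : seq (price R)) :
  (h <= 1)%N -> (forall q, q \in qs -> 0 <= q) ->
  (0 <= threshold_profit qs h x + (\sum_(q <- qs) q)%:E)%E.
Proof.
move=> h1 qs0; rewrite -[X in (X <= _)%E](@subee R (\sum_(q <- qs) q)%:E)//.
by rewrite addeC; apply: leeD2r; exact: threshold_profit_ge.
Qed.

(** Let h' be the stock after the first action and v the empty value of the remaining horizon. The
    rule makes gain + h' q equal to h q plus the selling excess if h = 1, the buying excess if h =
    0. The means are then A + v for h = 0, and S + q + v = (q + S - A) + (A + v) for h = 1. *)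
Lemma integral_threshold_profit_shift n (D : 'I_n -> probability (price R) R) h :
  admissible_law D -> integrable_revenue D -> (h <= 1)%N ->
  (\int[product_law D]_x (threshold_profit (thresholds D) h x +
     (\sum_(q <- thresholds D) q)%:E) =
   (h%:R * hold_value D + empty_value D + \sum_(q <- thresholds D) q)%:E)%E.
Proof.
elim: n D h => [|n IH] D h aD fD h1.
  rewrite /= big_nil mulr0 !addr0.
  under eq_integral do rewrite /threshold_profit profit_nil adde0.
  exact: integral0.
have aD' : admissible_law (fun i => D (lift ord0 i)) by move=> i; exact: aD.
have fD' : integrable_revenue (fun i => D (lift ord0 i)) by move=> i; exact: fD.
have q0 := hold_value_ge0 aD'.
have v0 := empty_value_ge0 (fun i => D (lift ord0 i)).
have C0 : 0 <= \sum_(q <- thresholds (fun i => D (lift ord0 i))) q.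
  by rewrite big_seq sumr_ge0// => q; exact: thresholds_ge0.
rewrite integral_product_lawS; last 2 first.
- by apply: emeasurable_funD => //; exact: measurable_threshold_profit.
- by move=> x; apply: threshold_profit_shift_ge0 => //; exact: thresholds_ge0.
rewrite /= big_cons.
move: (D ord0) (aD ord0) (fD ord0) => P aP fP.
move: (fun i => D (lift ord0 i)) aD' fD' q0 v0 C0 => D' aD' fD' q0 v0 C0.
move: (IH D') => {}IH; move: (@thresholds_ge0 _ _ _ aD') => ths0.
set q := hold_value D' in q0 IH *; set v := empty_value D' in v0 IH *.
set qs := thresholds D' in IH C0 ths0 *; set C := \sum_(j <- qs) j in C0 IH *.
pose exc p := if (0 < h)%N then sell_excess q p else buy_excess q p.
have -> : (\int[P]_p \int[product_law D']_x
    (threshold_profit (q :: qs) h (p :: x) + (q + C)%:E) =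
    \int[P]_p (exc p + (h%:R * q + v + (q + C))%:E))%E.
  apply: eq_integral => p _.
  pose a := threshold_rule q h p.
  (* The shift is shared out: q covers the first action and C the later ones, so both summands are
     nonnegative and the integral splits. *)
  transitivity (\int[product_law D']_x
     ((gain p a + q%:E) + (threshold_profit qs (next_stock h a) x + C%:E)))%E.
    apply: eq_integral => x _.
    by rewrite /threshold_profit /= profit_cons EFinD addeACA.
  have g0 : (0 <= gain p a + q%:E)%E.
    rewrite /a /threshold_rule; case: h h1 {exc a} => [|[]]//= _; case: ifP => //= pq.
    - by rewrite addeC sube_ge0 ?orbT// ltW.
    - by rewrite add0e.
    - by rewrite -EFinD lee_fin; move: (p.2 : R) pq => s pq; lra.
    - by rewrite add0e.
  rewrite ge0_integralD//; last 2 first.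
  - move=> x _; apply: threshold_profit_shift_ge0 => //.
    exact: next_stock_threshold_le1.
  - by apply: emeasurable_funD => //; exact: measurable_threshold_profit.
  rewrite integral_cst// [X in (_ * X)%E]probability_setT mule1 IH//; last first.
    exact: next_stock_threshold_le1.
  rewrite /exc /a /threshold_rule /sell_excess /buy_excess.
  (* Four cases, by stock and by trade or skip: the maximum in the excess is its first argument when
     the rule trades and 0 when it skips. *)
  case: h h1 {exc a g0} => [|[]]//= _; case: ifP => //= pq.
  - rewrite max_l; last by rewrite sube_ge0 ?orbT// ltW.
    rewrite -[adde _ _]/(- p.1 + q%:E)%E (addeC (- p.1)%E); congr (_ + _)%E.
    by congr EFin; lra.
  - rewrite max_r; last by rewrite sube_le0 ?orbT// leNgt pq.
    by rewrite !add0e -EFinD; congr EFin; lra.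
  - rewrite max_l; last by rewrite lee_fin subr_ge0 ltW.
    by rewrite -!EFinD; congr EFin; lra.
  - rewrite max_r; last by rewrite lee_fin subr_le0 leNgt pq.
    by rewrite !add0e -EFinD; congr EFin; lra.
rewrite integral_addcst; last 3 first.
- by rewrite !addr_ge0// mulr_ge0.
- rewrite /exc; case: (0 < h)%N.
    exact: measurable_sell_excess.
  exact: measurable_buy_excess.
- by move=> p; rewrite /exc; case: ifP => _; [exact: sell_excess_ge0|exact: buy_excess_ge0].
rewrite /exc; case: h h1 {exc} => [|[]]//= _.
- by rewrite integral_buy_excess// -EFinD; congr EFin; lra.
- by rewrite integral_sell_excess// -EFinD; congr EFin; lra.
Qed.

Lemma integral_threshold_profit n (D : 'I_n -> probability (price R) R) h :
  admissible_law D -> integrable_revenue D -> (h <= 1)%N ->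
  (\int[product_law D]_x threshold_profit (thresholds D) h x =
   (h%:R * hold_value D + empty_value D)%:E)%E.
Proof.
move=> aD fD h1; set C := \sum_(q <- thresholds D) q.
pose F (x : n.-tuple (price R)) := (threshold_profit (thresholds D) h x + C%:E)%E.
have mF : measurable_fun [set: n.-tuple (price R)] F.
  by apply: emeasurable_funD => //; exact: measurable_threshold_profit.
have F0 x : (0 <= F x)%E.
  by apply: threshold_profit_shift_ge0 => //; exact: thresholds_ge0.
have IF := integral_threshold_profit_shift aD fD h1.
have iF : (product_law D).-integrable [set: n.-tuple (price R)] F.
  apply/integrableP; split => //.
  under eq_integral do rewrite gee0_abs//.
  by rewrite IF ltry.
(* The shifted profit is nonnegative with finite mean, hence integrable, so the constant can be
   subtracted again. *)
transitivity (\int[product_law D]_x (F \- cst C%:E) x)%E.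
  by apply: eq_integral => x _; rewrite /F /= addeK.
rewrite integralB//; last exact: finite_measure_integrable_cst.
rewrite [X in (X - _)%E]IF integral_cst// [X in (_ * X)%E]probability_setT mule1.
by rewrite -EFinB addrK.
Qed.

(** * Bound on offline strategies *)

(** The sum over t in the offline bound, without the leading q_0. The mean A_t enters because q_t -
    q_(t-1) = A_t - S_t <= A_t. *)
Fixpoint offline_bound n :
    ('I_n -> probability (price R) R) -> seq (price R) -> \bar R :=
  match n with
  | 0 => fun _ _ => 0%E
  | m.+1 => fun D x =>
      let D' := fun i => D (lift ord0 i) in
      let q := hold_value D' in
      if x is p :: x' then
        (buy_excess q p + sell_excess q p + (mean_buy_excess (D ord0) q)%:E +
         offline_bound D' x')%E
      else 0%E
  end.

Lemma offline_bound_ge0 n (D : 'I_n -> probability (price R) R) x :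
  (0 <= offline_bound D x)%E.
Proof.
elim: n D x => [|n IH] D [|p x] //=.
by rewrite !adde_ge0// ?buy_excess_ge0 ?sell_excess_ge0// lee_fin mean_buy_excess_ge0.
Qed.

Lemma measurable_offline_bound n (D : 'I_n -> probability (price R) R) :
  measurable_fun [set: n.-tuple (price R)] (fun x => offline_bound D x).
Proof.
elim: n D => [|n IH] D //=.
set q := hold_value _.
have mth : measurable_fun [set: n.+1.-tuple (price R)] (@thead n (price R)).
  exact: measurable_tnth.
rewrite (_ : (fun _ => _) = fun x : n.+1.-tuple (price R) =>
  (buy_excess q (thead x) + sell_excess q (thead x) +
   (mean_buy_excess (D ord0) q)%:E +
   offline_bound (fun i => D (lift ord0 i)) [tuple of behead x])%E).
  apply: emeasurable_funD; last first.
    exact: (measurableT_comp (IH _) (@measurable_behead _ _ _)).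
  apply: emeasurable_funD => //; apply: emeasurable_funD.
    exact: (measurableT_comp (measurable_buy_excess q) mth).
  exact: (measurableT_comp (measurable_sell_excess q) mth).
by apply/funext => x; rewrite (tuple_eta x) /= theadE.
Qed.

(** Step t has mean 2 A_t + S_t, and telescoping from q_T = 0 shows that the S_t sum to q_0 plus the
    sum of the A_t. *)
Lemma integral_offline_bound n (D : 'I_n -> probability (price R) R) :
  admissible_law D -> integrable_revenue D ->
  (\int[product_law D]_x offline_bound D x =
   (hold_value D + 3 * empty_value D)%:E)%E.
Proof.
elim: n D => [|n IH] D aD fD.
  by rewrite /= mulr0 addr0 integral0.
have aD' : admissible_law (fun i => D (lift ord0 i)) by move=> i; exact: aD.
have fD' : integrable_revenue (fun i => D (lift ord0 i)) by move=> i; exact: fD.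
have q0 := hold_value_ge0 aD'.
have v0 := empty_value_ge0 (fun i => D (lift ord0 i)).
rewrite integral_product_lawS; last 2 first.
- exact: measurable_offline_bound.
- by move=> x; exact: offline_bound_ge0.
rewrite /=.
move: (D ord0) (aD ord0) (fD ord0) => P aP fP.
move: (fun i => D (lift ord0 i)) aD' fD' q0 v0 => D' aD' fD' q0 v0.
move: (IH D' aD' fD') => {}IH.
set q := hold_value D' in q0 IH *; set v := empty_value D' in v0 IH *.
set A := mean_buy_excess P q.
have A0 : 0 <= A := mean_buy_excess_ge0 P q.
have -> : (\int[P]_p \int[product_law D']_x
    (buy_excess q p + sell_excess q p + A%:E + offline_bound D' x) =
    \int[P]_p (buy_excess q p + sell_excess q p + (A + (q + 3 * v))%:E))%E.
  apply: eq_integral => p _.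
  rewrite ge0_integralD//; last 3 first.
  - by move=> x _; rewrite !adde_ge0// ?buy_excess_ge0 ?sell_excess_ge0.
  - by move=> x _; exact: offline_bound_ge0.
  - exact: measurable_offline_bound.
  by rewrite integral_cst// [X in (_ * X)%E]probability_setT mule1 IH [in RHS]EFinD addeA.
rewrite integral_addcst; last 3 first.
- by rewrite !addr_ge0// mulr_ge0.
- by apply: emeasurable_funD; [exact: measurable_buy_excess|exact: measurable_sell_excess].
- by move=> p; rewrite adde_ge0 ?buy_excess_ge0 ?sell_excess_ge0.
rewrite ge0_integralD//; last 4 first.
- by move=> p _; exact: buy_excess_ge0.
- exact: measurable_buy_excess.
- by move=> p _; exact: sell_excess_ge0.
- exact: measurable_sell_excess.
rewrite integral_buy_excess// integral_sell_excess// -!EFinD -/A.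
by congr EFin; lra.
Qed.

(** Telescoping of the potential h_t q_t, done as an induction: one step changes gain plus potential
    by at most the two excesses plus A_t. *)
Lemma profit_le_offline_bound n (D : 'I_n -> probability (price R) R) h x acts :
  (h <= 1)%N -> size x = n -> feasible 1 h x acts ->
  (profit x acts <= (h%:R * hold_value D)%:E + offline_bound D x)%E.
Proof.
elim: n D h x acts => [|n IH] D h [|p x] [|a acts] //= h1.
  by rewrite profit_nil mulr0 adde0.
move=> [sx] /andP[al fe].
have h'1 : (next_stock h a <= 1)%N.
  by case: a al {fe} => //=; [case/andP; case: h h1|move=> _; case: h h1 => [|[]]].
rewrite profit_cons.
have := IH (fun i => D (lift ord0 i)) _ _ _ h'1 sx fe.
move=> /(leeD2l (gain p a)) /le_trans; apply.
rewrite !addeA; apply: leeD2r; rewrite -!addeA.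
set q := hold_value _.
have S0 := mean_sell_excess_ge0 (D ord0) q.
have A0 := mean_buy_excess_ge0 (D ord0) q.
set S := mean_sell_excess _ _ in S0 *; set A := mean_buy_excess _ _ in A0 *.
have be0 := buy_excess_ge0 q p; have se0 := sell_excess_ge0 q p.
(* From an empty stock, a purchase is paid for by the buying excess. With a copy held, q_(t-1) + A_t
   = q_t + S_t >= q_t, which pays for skipping and, with the selling excess, for selling. *)
case: h h1 al h'1 {fe} => [|[]]//= _; case: a => //= al _.
- rewrite mul1r mul0r add0e addeC -[leLHS]adde0.
  apply: leeD; first by rewrite /buy_excess le_max lexx.
  by rewrite adde_ge0// lee_fin.
- by rewrite !mul0r !add0e !adde_ge0// lee_fin.
- rewrite mul0r adde0 mul1r.
  apply: (@le_trans _ _ ((q + S - A)%:E + (0 + (((p.2 : R) - q)%:E + A%:E)))%E).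
    by rewrite add0e -!EFinD lee_fin; lra.
  apply: leeD2l; apply: leeD => //; apply: leeD2r.
  by rewrite /sell_excess le_max lexx.
- rewrite !mul1r add0e.
  apply: (@le_trans _ _ ((q + S - A)%:E + (0 + (0 + A%:E)))%E).
    by rewrite !add0e -!EFinD lee_fin; lra.
  by apply: leeD2l; apply: leeD => //; apply: leeD.
Qed.

Lemma feasible_skip B h (x : seq (price R)) :
  feasible B h x (nseq (size x) Skip).
Proof. by elim: x. Qed.

Lemma profit_skip (x : seq (price R)) : profit x (nseq (size x) Skip) = 0%E.
Proof.
by elim: x => [|p x IH] /=; rewrite ?profit_nil// profit_cons /= IH add0e.
Qed.

Lemma offline_profit_ge0 (B B0 T : nat) (x : T.-tuple (price R)) :
  (0 <= offline_profit B B0 x)%E.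
Proof.
pose a : T.-tuple action := [tuple of nseq T Skip].
rewrite -(profit_skip x) size_tuple.
apply: (le_bigmax_cond _ (fun a => profit x a) (j := a)).
by rewrite /= -{2}(size_tuple x) feasible_skip.
Qed.

Lemma offline_profit_le n (D : 'I_n -> probability (price R) R) h
    (x : n.-tuple (price R)) : (h <= 1)%N ->
  (offline_profit 1 h x <= (h%:R * hold_value D)%:E + offline_bound D x)%E.
Proof.
move=> h1; apply: bigmax_le => [|a fa]; first exact: leNye.
by apply: profit_le_offline_bound => //; rewrite size_tuple.
Qed.

End values.

(** * Packaging the policy as an algorithm and comparing means *)

Lemma measurable_set_cst d (T : measurableType d) (P : Prop) :
  measurable [set _ : T | P].
Proof.
have [p|np] := pselect P.
  by rewrite (_ : mkset _ = setT)//; apply/seteqP; split.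
by rewrite (_ : mkset _ = set0)//; apply/seteqP; split.
Qed.

(** The seed is the one-point space [unit] with its Dirac measure, and [integral_snd] removes it
    from the expectation. *)
Lemma deterministic_algorithm (R : realType) (I : atp_instance R)
    (d : seq (price R) -> seq action -> action)
    (f : (horizon I).-tuple (price R) -> \bar R) :
  (forall n past a, measurable [set x : n.-tuple (price R) | d x past = a]) ->
  (forall x : (horizon I).-tuple (price R),
    feasible (capacity I) (initial I) x
      (play (fun _ : unit => d) tt x (horizon I))) ->
  measurable_fun [set: (horizon I).-tuple (price R)] f ->
  (forall x : (horizon I).-tuple (price R),
    profit x (play (fun _ : unit => d) tt x (horizon I)) = f x) ->
  exists A : online_algorithm I,
    expected_online_profit A = (\int[product_law (@law R I)]_x f x)%E.
Proof.
move=> md fd mf df.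
have mu n past a :
    measurable [set z : unit * n.-tuple (price R) | d z.2 past = a].
  have := @measurable_snd _ _ unit (n.-tuple (price R)) measurableT _ (md n past a).
  by rewrite setTI.
exists (@OnlineAlgorithm R I _ unit (\d_tt) (fun _ => d) mu
  (fun w x => match w with tt => fd x end)).
rewrite /expected_online_profit /= -[RHS](integral_snd \d_tt)//.
by apply: eq_integral => -[[] x] _; rewrite /= df.
Qed.

Lemma threshold_algorithm (R : realType) (I : atp_instance R) :
  capacity I = 1%N -> initial I = 1%N -> integrable_revenue (@law R I) ->
  exists A : online_algorithm I, expected_online_profit A =
    (hold_value (@law R I) + empty_value (@law R I))%:E.
Proof.
move=> hB hB0 fD.
have aD : admissible_law (@law R I) := @law_admissible R I.
set qs := thresholds (@law R I).
have playE (x : (horizon I).-tuple (price R)) :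
    play (fun _ : unit => threshold_decide qs 1) tt x (horizon I) =
    threshold_acts qs 1 x.
  by rewrite play_threshold ?size_thresholds ?size_tuple.
have [||||A AE] := @deterministic_algorithm R I (threshold_decide qs 1)
    (fun x => threshold_profit qs 1 x).
- move=> n past a; rewrite /threshold_decide.
  have [sn|ns] := ltnP (size past) n.
    rewrite (_ : [set _ | _] = (@tnth n _ ^~ (Ordinal sn)) @^-1`
      [set p | threshold_rule (nth 0 qs (size past))
                 (foldl next_stock 1%N past) p = a]).
      rewrite -[X in measurable X]setTI; apply: measurable_tnth => //.
      exact: measurable_threshold_rule.
    by apply/seteqP; split=> x /=; rewrite (tnth_nth (0%E, 0)).
  (* With at least as many past actions as revealed tuples, the rule reads the default price, so the
     event does not depend on [x]. *)
  have nthE (x : n.-tuple (price R)) : nth (0%E, 0) x (size past) = (0%E, 0).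
    by rewrite nth_default// size_tuple.
  rewrite (_ : [set _ | _] = [set _ | threshold_rule (nth 0 qs (size past))
     (foldl next_stock 1%N past) (0%E, 0) = a]).
    exact: measurable_set_cst.
  by apply/seteqP; split=> x /=; rewrite nthE.
- by move=> x; rewrite playE hB hB0 feasible_threshold// size_thresholds size_tuple.
- exact: measurable_threshold_profit.
- by move=> x; rewrite playE.
by exists A; rewrite AE integral_threshold_profit// mul1r.
Qed.

(** One q_0 is the potential of the initial copy, the other comes from the mean of
    [offline_bound]. *)
Lemma expected_offline_profit_le (R : realType) (I : atp_instance R) :
  capacity I = 1%N -> initial I = 1%N -> integrable_revenue (@law R I) ->
  (expected_offline_profit I <=
    (2 * hold_value (@law R I) + 3 * empty_value (@law R I))%:E)%E.
Proof.
move=> hB hB0 fD.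
have aD : admissible_law (@law R I) := @law_admissible R I.
rewrite /expected_offline_profit hB hB0.
apply: (@le_trans _ _ (\int[product_law (@law R I)]_x
  ((hold_value (@law R I))%:E + offline_bound (@law R I) x))%E).
  apply: ge0_le_integral_nonmeasurable => x; first exact: offline_profit_ge0.
  by have := offline_profit_le (@law R I) x (leqnn 1); rewrite mul1r.
have h0 := hold_value_ge0 aD.
rewrite ge0_integralD//; last 2 first.
- by move=> x _; exact: offline_bound_ge0.
- exact: measurable_offline_bound.
rewrite integral_cst// [X in (_ * X)%E]probability_setT mule1.
by rewrite integral_offline_bound// -EFinD lee_fin; lra.
Qed.

(** * Infinite expected revenue at some time *)

Lemma integral_product_law_tnth (R : realType) (T : nat)
    (D : 'I_T -> probability (price R) R) (t : 'I_T) (f : price R -> \bar R) :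
  measurable_fun [set: price R] f -> (forall p, 0 <= f p)%E ->
  (\int[product_law D]_x f (tnth x t) = \int[D t]_p f p)%E.
Proof.
move=> mf f0.
have mt := @measurable_tnth _ (price R) T t.
rewrite -(@ge0_integral_pushforward _ _ _ _ _ _ mt (product_law D) setT f)//.
apply: eq_measure_integral => A mA _.
(* The event that coordinate t lies in [A] is a box with side [A] at t and the whole space
   elsewhere, so [product_law_box] gives its mass. *)
pose B j := if j == t then A else [set: price R].
have := @product_law_box R T D B.
rewrite /pushforward (_ : [set x | _] = (@tnth T _ ^~ t) @^-1` A); last first.
  apply/seteqP; split=> x /=; first by move=> /(_ t); rewrite /B eqxx.
  by move=> At j; rewrite /B; case: eqP => [->|].
have mB j : measurable (B j) by rewrite /B; case: ifP.
move=> /(_ mB) Bt; etransitivity; first exact: Bt.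
rewrite (bigD1 t)//= big1 ?mule1 /B ?eqxx// => j /negbTE ->.
exact: probability_setT.
Qed.

Lemma mkseqSl (T : Type) (e : nat -> T) n :
  mkseq e n.+1 = e 0%N :: mkseq (fun i => e i.+1) n.
Proof. by rewrite /mkseq /= (iotaDl 1 0) -map_comp. Qed.

Definition sell_at (t i : nat) : action := if i == t then Sell else Skip.

Lemma feasible_sell_at (R : realType) B (x : seq (price R)) t :
  feasible B 1 x (mkseq (sell_at t) (size x)).
Proof.
elim: x t => [//|p x IH] [|t]; rewrite [size _]/= mkseqSl /=; last exact: IH.
rewrite (_ : mkseq _ _ = nseq (size x) Skip) ?feasible_skip//.
by elim: (size x) => // n {}IH; rewrite mkseqSl IH.
Qed.

Lemma profit_sell_at (R : realType) (x : seq (price R)) t : (t < size x)%N ->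
  profit x (mkseq (sell_at t) (size x)) = ((nth (0%E, 0) x t).2 : R)%:E.
Proof.
elim: x t => [//|p x IH] [|t] tx; rewrite [size _]/= mkseqSl profit_cons /=.
  rewrite (_ : mkseq _ _ = nseq (size x) Skip) ?profit_skip ?adde0//.
  by elim: (size x) => // n {}IH; rewrite mkseqSl IH.
by rewrite add0e IH.
Qed.

Lemma sell_at_algorithm (R : realType) (I : atp_instance R)
    (t : 'I_(horizon I)) :
  initial I = 1%N -> (\int[law t]_p sell_excess 0 p = +oo)%E ->
  exists A : online_algorithm I, expected_online_profit A = +oo%E.
Proof.
move=> hB0 infs.
pose d (x : seq (price R)) (past : seq action) := sell_at t (size past).
have playE x n : play (fun _ : unit => d) tt x n = mkseq (sell_at t) n.
  by elim: n => // n IH; rewrite mkseqS /= -IH /d size_play.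
pose f (x : (horizon I).-tuple (price R)) : \bar R := ((tnth x t).2 : R)%:E.
have mf : measurable_fun [set: (horizon I).-tuple (price R)] f.
  apply/measurable_EFinP.
  exact: (measurableT_comp measurable_snd (measurable_tnth t)).
have [||//||A AE] := @deterministic_algorithm R I d f.
- move=> n past a; rewrite /d; exact: measurable_set_cst.
- move=> x; rewrite playE hB0.
  by have := feasible_sell_at (capacity I) x t; rewrite size_tuple.
- move=> x; rewrite playE /f (tnth_nth (0%E, 0)) -profit_sell_at ?size_tuple//.
exists A; rewrite AE integralE.
pose g (p : price R) : \bar R := maxe (- (p.2 : R))%:E 0%E.
have mg : measurable_fun [set: price R] g.
  apply: measurable_maxe => //; apply/measurable_EFinP.
  by apply: measurableT_comp => //; exact: measurable_snd.
(* Almost surely s_t >= 0, so the negative part integrates to 0; the positive part is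
   [sell_excess 0], of infinite mean. *)
have -> : (\int[product_law (@law R I)]_x f^\- x = 0)%E.
  transitivity (\int[product_law (@law R I)]_x g (tnth x t))%E.
    by apply: eq_integral => x _; rewrite funenegE.
  rewrite (integral_product_law_tnth _ _ mg); last first.
    by move=> p; rewrite /g le_max lexx orbT.
  rewrite -(integral0 (law t) setT); apply: ge0_ae_eq_integral => //.
    by move=> p _; rewrite /g le_max lexx orbT.
  apply: filterS (ae_admissible (law_admissible t)) => p [_ p0] _.
  by rewrite /g max_r// lee_fin oppr_le0.
rewrite sube0 -infs.
rewrite -(integral_product_law_tnth _ _ (measurable_sell_excess 0)); last first.
  exact: sell_excess_ge0.
by apply: eq_integral => x _; rewrite funeposE /sell_excess subr0.
Qed.

Theorem theorem1p2 (R : realType) (I : atp_instance R)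
    (hB : capacity I = 1%N) (hB0 : initial I = 1%N) :
  exists A : online_algorithm I,
    ((22^-1 : R)%R%:E * expected_offline_profit I <= expected_online_profit A)%E.
Proof.
have [fD|] := pselect (integrable_revenue (@law R I)); last first.
  move=> /existsNP[t /negP]; rewrite -leNgt leye_eq => /eqP infs.
  have [A AE] := sell_at_algorithm hB0 infs.
  by exists A; rewrite AE leey.
have [A AE] := threshold_algorithm hB hB0 fD.
exists A; rewrite AE; apply: (@le_trans _ _ (22^-1%:E *
    (2 * hold_value (@law R I) + 3 * empty_value (@law R I))%:E)%E).
  by apply: lee_wpmul2l; [rewrite lee_fin invr_ge0|exact: expected_offline_profit_le].
have h0 := hold_value_ge0 (@law_admissible R I).
have v0 := empty_value_ge0 (@law R I).
(* With q_0 and the sum v of the A_t nonnegative, 2 q_0 + 3 v <= 3 (q_0 + v), well within the factor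
   22. *)
by rewrite -EFinM lee_fin; lra.
Qed.
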